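(* Let $\mathbb{F}$ be a field and let $\ominus$ be the uniform Kronecker difference given by a sequence of matrices $\upsilon_n\in\mathbb{F}_n$ with $\operatorname{tr}(\upsilon_n)=1$, $n\in\mathbb{N}$, via $$A\ominus B=\operatorname{tr}_{12}\bigl(\alpha_{m,n}^T(A\otimes I_m-I_m\otimes B\otimes I_m)\bigr),\qquad \alpha_{m,n}:=\sum_{i,j=1}^m E_{ij}\otimes\upsilon_n\otimes E_{ji},$$ for all $A\in\mathbb{F}_m\otimes\mathbb{F}_n$, $B\in\mathbb{F}_n$ and $m,n\in\mathbb{N}$. The following are equivalent: (a) for all $X\in\mathbb{F}_m\otimes\mathbb{F}_p\otimes\mathbb{F}_q$, $Y\in\mathbb{F}_q$, $Z\in\mathbb{F}_p$ and $m,p,q\in\mathbb{N}$: $(X\ominus Y)\ominus Z=X\ominus(Z\oplus Y)$; (b) for each prime number $p\in\mathbb{N}$ there exists a unique $\pi_p\in\mathbb{F}_p$ with $\operatorname{tr}(\pi_p)=1$ such that: if $n\in\mathbb{N}$ has the prime decomposition $n=p_1^{j_1}\cdots p_r^{j_r}$, where $r\in\mathbb{N}$, $j_1,\ldots,j_r\in\mathbb{N}$ and $p_1,\ldots,p_r$ are distinct prime numbers, then $\upsilon_n$ has the unique decomposition $$\upsilon_n=\pi_{p_1}^{\otimes^{j_1}}\otimes\cdots\otimes\pi_{p_r}^{\otimes^{j_r}},$$ where $\mathbb{F}_n=\mathbb{F}_{p_1}^{\otimes^{j_1}}\otimes\cdots\otimes\mathbb{F}_{p_r}^{\otimes^{j_r}}$,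 and for every product of prime numbers $q_1\cdots q_k$ such that $n=q_1\cdots q_k$, $k=j_1+\cdots+j_r$, $$\upsilon_n=\pi_{p_1}^{\otimes^{j_1}}\otimes\cdots\otimes\pi_{p_r}^{\otimes^{j_r}}=\pi_{q_1}\otimes\cdots\otimes\pi_{q_k}.$$
   Context: $\mathbb{F}_m$ is the space of $m\times m$ matrices over $\mathbb{F}$, $\mathbb{N}$ is the set of positive integers, $\otimes$ is the Kronecker product, and $\mathbb{F}_m\otimes\mathbb{F}_n$ is identified with $\mathbb{F}_{mn}$. $x^{\otimes^j}$ denotes $x\otimes\cdots\otimes x$ with $j$ factors. $E_{ij}$ is the matrix unit with a $1$ in position $(i,j)$ and zeros elsewhere (here of size $m\times m$), and $I_m$ is the identity matrix. The Kronecker sum of $A\in\mathbb{F}_m$ and $B\in\mathbb{F}_n$ is $A\oplus B=A\otimes I_n+I_m\otimes B$. A Kronecker difference is a family of operations $\ominus:\mathbb{F}_{mn}\times\mathbb{F}_n\to\mathbb{F}_m$, indexed by $m,n\in\mathbb{N}$, such that $(A\oplus B)\ominus B=A$ for all $A\in\mathbb{F}_m$, $B\in\mathbb{F}_n$, $m,n\in\mathbb{N}$. It is uniform if $(A\oplus C)\ominus B=A\oplus(C\ominus B)$ for all $A\in\mathbb{F}_m$, $B\in\mathbb{F}_n$, $C\in\mathbb{F}_p\otimes\mathbb{F}_n$ and $m,n,p\in\mathbb{N}$, and moreover $(A+B)\ominus(C+D)=(A\ominus C)+(B\ominus D)$ and $(kA)\ominus(kC)=k(A\ominus C)$ for all matrices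 $A,B,C,D$ and scalars $k\in\mathbb{F}$ whenever the operations are defined. (The operation given by the displayed formula is always a uniform Kronecker difference.) $\operatorname{tr}_{12}:\mathbb{F}_m\otimes\mathbb{F}_n\otimes\mathbb{F}_m\to\mathbb{F}_m$ is the linear map with $\operatorname{tr}_{12}(A\otimes B\otimes C)=\operatorname{tr}(A)\operatorname{tr}(B)\,C$. *)

(* Defs.v *)
(* The Kronecker product of matrices is the one of mathcomp-real-closed: for
   A : 'M_m and B : 'M_n,
     A *t B : 'M_(m * n) is the Kronecker product (row-major indexing) and
     A ^t j : 'M_(m ^ j) is the Kronecker power with j factors. *)
From mathcomp Require Import all_boot all_order all_algebra.
From mathcomp.real_closed Require Export mxtens.

Set Implicit Arguments.
Unset Strict Implicit.
Unset Printing Implicit Defensive.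

Import GRing.Theory.
Local Open Scope ring_scope.

(* Transport along an equality of sizes: F_m (x) (F_p (x) F_q) has size
   m * (p * q), while (F_m (x) F_p) (x) F_q has size m * p * q, and the two are
   only propositionally equal. *)
Definition castsq (F : fieldType) (m n : nat) (e : m = n) (A : 'M[F]_m) :
  'M[F]_n := castmx (e, e) A.

Definition kronsum (F : fieldType) (m n : nat) (A : 'M[F]_m) (B : 'M[F]_n) :
  'M[F]_(m * n) := A *t 1%:M + 1%:M *t B.

(* The partial trace over the first two tensor factors; see tr12_linear and
   tr12_tens. *)
Definition tr12 (F : fieldType) (m n p : nat) (M : 'M[F]_(m * n * p)) :
  'M[F]_p :=
  \matrix_(k, l) \sum_(i < m * n) M (mxtens_index (i, k)) (mxtens_index (i, l)).

(* Square matrices of size 0 exist here, so a family v has an irrelevant member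
   at 0; positivity of the sizes is assumed wherever it matters. *)
Definition alpha (F : fieldType) (v : forall n : nat, 'M[F]_n) (m n : nat) :
  'M[F]_(m * n * m) :=
  \sum_(i < m) \sum_(j < m) delta_mx i j *t v n *t delta_mx j i.

Definition kdiff (F : fieldType) (v : forall n : nat, 'M[F]_n) (m n : nat)
  (A : 'M[F]_(m * n)) (B : 'M[F]_n) : 'M[F]_m :=
  tr12 ((alpha v m n)^T *m (A *t 1%:M - 1%:M *t B *t 1%:M)).

Definition kronecker_difference (F : fieldType)
  (op : forall m n : nat, 'M[F]_(m * n) -> 'M[F]_n -> 'M[F]_m) : Prop :=
  forall m n : nat, (0 < m)%N -> (0 < n)%N ->
  forall (A : 'M[F]_m) (B : 'M[F]_n), op m n (kronsum A B) B = A.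

Definition uniform_kronecker_difference (F : fieldType)
  (op : forall m n : nat, 'M[F]_(m * n) -> 'M[F]_n -> 'M[F]_m) : Prop :=
  [/\ kronecker_difference op,
      forall m n p : nat, (0 < m)%N -> (0 < n)%N -> (0 < p)%N ->
        forall (A : 'M[F]_m) (B : 'M[F]_n) (C : 'M[F]_(p * n)),
        op (m * p)%N n (castsq (mulnA m p n) (kronsum A C)) B
        = kronsum A (op p n C B),
      forall m n : nat, (0 < m)%N -> (0 < n)%N ->
        forall (A B : 'M[F]_(m * n)) (C D : 'M[F]_n),
        op m n (A + B) (C + D) = op m n A C + op m n B D
    & forall m n : nat, (0 < m)%N -> (0 < n)%N ->
        forall (k : F) (A : 'M[F]_(m * n)) (C : 'M[F]_n),
        op m n (k *: A) (k *: C) = k *: op m n A C].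

Lemma prodn_cons (I : Type) (d : I -> nat) (i : I) (s : seq I) :
  (d i * \prod_(j <- s) d j = \prod_(j <- i :: s) d j)%N.
Proof. by rewrite big_cons. Qed.

Lemma prodn_nil (I : Type) (d : I -> nat) : (1 = \prod_(j <- [::]) d j)%N.
Proof. by rewrite big_nil. Qed.

(* The Kronecker product, in order, of the matrices M i for i along s. *)
Fixpoint kronprod (F : fieldType) (I : Type) (d : I -> nat)
  (M : forall i : I, 'M[F]_(d i)) (s : seq I) : 'M[F]_(\prod_(i <- s) d i)%N :=
  match s with
  | [::] => castsq (prodn_nil d) (1%:M : 'M[F]_1)
  | i :: s' => castsq (prodn_cons d i s') (M i *t kronprod M s')
  end.

(* s = [:: (p_1, j_1); ...; (p_r, j_r)], in any order, with r > 0. *)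
Definition prime_decomposition (n : nat) (s : seq (nat * nat)) : Prop :=
  [/\ (0 < size s)%N,
      uniq [seq f.1 | f <- s],
      all (fun f => prime f.1 && (0 < f.2)%N) s
    & \prod_(f <- s) f.1 ^ f.2 = n]%N.

(* pi_(p_1)^(j_1) (x) ... (x) pi_(p_r)^(j_r). *)
Definition kronpowers (F : fieldType) (pi : forall p : nat, 'M[F]_p)
  (s : seq (nat * nat)) : 'M[F]_(\prod_(f <- s) f.1 ^ f.2)%N :=
  kronprod (fun f => pi f.1 ^t f.2) s.

(* pi_(q_1) (x) ... (x) pi_(q_k). *)
Definition kronprimes (F : fieldType) (pi : forall p : nat, 'M[F]_p)
  (q : seq nat) : 'M[F]_(\prod_(i <- q) i)%N :=
  kronprod (d := id) pi q.

(* Only the members of pi at the prime numbers matter. The middle clause is the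
   uniqueness of the decomposition: its factors are determined by v n among the
   matrices of trace one (without the normalization of the traces, factors could
   be rescaled against each other). *)
Definition prime_factorization_family (F : fieldType)
  (v pi : forall n : nat, 'M[F]_n) : Prop :=
  (forall p : nat, prime p -> \tr (pi p) = 1) /\
  forall (n : nat) (s : seq (nat * nat)), prime_decomposition n s ->
  forall e : (\prod_(f <- s) f.1 ^ f.2)%N = n,
  [/\ v n = castsq e (kronpowers pi s),
      forall sigma : forall p : nat, 'M[F]_p,
        (forall f, f \in s -> \tr (sigma f.1) = 1) ->
        v n = castsq e (kronpowers sigma s) ->
        forall f, f \in s -> sigma f.1 = pi f.1
    & forall q : seq nat, all prime q ->
        size q = (\sum_(f <- s) f.2)%N ->
        forall e' : (\prod_(i <- q) i)%N = n,
        castsq e (kronpowers pi s) = castsq e' (kronprimes pi q)].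

Section Facts.
Variable F : fieldType.

Lemma tr12_linear m n p : linear (@tr12 F m n p).
Proof.
move=> k A B; apply/matrixP=> i j; rewrite !mxE big_distrr -big_split /=.
by apply: eq_bigr => l _; rewrite !mxE.
Qed.

Lemma sum_mxtens m n (f : 'I_(m * n) -> F) :
  \sum_i f i = \sum_(i < m) \sum_(j < n) f (mxtens_index (i, j)).
Proof.
rewrite pair_big (reindex (@mxtens_index m n)) /=.
  by apply: eq_bigr => -[].
by exists (@mxtens_unindex m n) => i _; rewrite (mxtens_indexK, mxtens_unindexK).
Qed.

Lemma mxtrace_tens m n (A : 'M[F]_m) (B : 'M[F]_n) :
  \tr (A *t B) = \tr A * \tr B.
Proof.
rewrite /mxtrace sum_mxtens mulr_suml; apply: eq_bigr => i _.
by rewrite mulr_sumr; apply: eq_bigr => j _; rewrite tensmxE.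
Qed.

Lemma tr12_tens2 m n p (A : 'M[F]_(m * n)) (C : 'M[F]_p) :
  tr12 (A *t C) = \tr A *: C.
Proof.
apply/matrixP=> i j; rewrite !mxE /mxtrace mulr_suml.
by apply: eq_bigr => l _; rewrite tensmxE.
Qed.

Lemma tr12_tens m n p (A : 'M[F]_m) (B : 'M[F]_n) (C : 'M[F]_p) :
  tr12 (A *t B *t C) = (\tr A * \tr B) *: C.
Proof. by rewrite tr12_tens2 mxtrace_tens. Qed.

Lemma tr12_sum m n p I (r : seq I) (f : I -> 'M[F]_(m * n * p)) :
  tr12 (\sum_(i <- r) f i) = \sum_(i <- r) tr12 (f i).
Proof.
apply/matrixP=> i j; rewrite mxE summxE.
rewrite (eq_bigr (fun k => \sum_(l <- r)
  f l (mxtens_index (k, i)) (mxtens_index (k, j)))) => [|k _].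
  by rewrite exchange_big; apply: eq_bigr => l _; rewrite mxE.
by rewrite summxE.
Qed.

Lemma kdiffE (v : forall n : nat, 'M[F]_n) m n (A : 'M_(m * n)) (B : 'M_n) i j :
  kdiff v A B i j = \sum_(k < n) \sum_(l < n) v n k l *
    (A - 1%:M *t B) (mxtens_index (i, k)) (mxtens_index (j, l)).
Proof.
rewrite /kdiff; set W := A - _.
have -> : A *t 1%:M - 1%:M *t B *t 1%:M = W *t (1%:M : 'M[F]_m).
  by apply/matrixP=> x y; rewrite !mxE mulrBl.
rewrite /alpha raddf_sum mulmx_suml tr12_sum summxE (bigD1 i) //=.
rewrite raddf_sum mulmx_suml tr12_sum summxE (bigD1 j) //=.
rewrite [X in _ + X]big1 ?addr0 => [|i' ne]; last first.
  rewrite raddf_sum mulmx_suml tr12_sum summxE big1 // => j' _.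
  rewrite /= !trmx_tens tensmx_mul mulmx1 tr12_tens2 !trmx_delta !mxE.
  by rewrite [i == i']eq_sym (negPf ne) mulr0n mulr0.
rewrite [X in _ + X]big1 ?addr0 => [|j' ne]; last first.
  rewrite !trmx_tens tensmx_mul mulmx1 tr12_tens2 !trmx_delta !mxE.
  by rewrite [j == j']eq_sym (negPf ne) andbF mulr0n mulr0.
rewrite !trmx_tens tensmx_mul mulmx1 tr12_tens2 !trmx_delta !mxE !eqxx mulr1.
rewrite /mxtrace sum_mxtens (bigD1 j) //= [X in _ + X]big1 ?addr0 => [|j' ne].
  rewrite exchange_big /=; apply: eq_bigr => l _.
  rewrite mxE sum_mxtens (bigD1 i) //= [X in _ + X]big1 ?addr0 => [|i' ne].
    by apply: eq_bigr => k _; rewrite tensmxE !mxE !eqxx mul1r.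
  by rewrite big1 // => k _; rewrite tensmxE !mxE (negPf ne) andbF mulr0n !mul0r.
rewrite big1 // => l _; rewrite mxE sum_mxtens big1 // => i' _.
by rewrite big1 // => k _; rewrite tensmxE !mxE (negPf ne) mulr0n !mul0r.
Qed.

Lemma kdiff_uniform (v : forall n : nat, 'M[F]_n)
  (v_tr1 : forall n : nat, (0 < n)%N -> \tr (v n) = 1) :
  uniform_kronecker_difference (@kdiff F v).
Proof.
have tr1 n (x : F) : (0 < n)%N ->
    \sum_(k < n) \sum_(l < n) v n k l * (x * (k == l)%:R) = x.
  move=> /v_tr1; rewrite /mxtrace => tv.
  rewrite -[RHS]mul1r -[in RHS]tv mulr_suml; apply: eq_bigr => k _.
  rewrite (bigD1 k) //= eqxx mulr1n mulr1 big1 ?addr0 // => l ne.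
  by rewrite eq_sym (negPf ne) mulr0n !mulr0.
split.
- move=> m n _ n0 A B; apply/matrixP=> i j; rewrite kdiffE.
  rewrite -[RHS](tr1 n) //; apply: eq_bigr => k _; apply: eq_bigr => l _.
  by rewrite /kronsum addrK tensmxE mxE.
- move=> m n p _ n0 _ A B C; apply/matrixP=> x y; rewrite kdiffE.
  case: (mxtens_indexP x) => i a; case: (mxtens_indexP y) => j b.
  rewrite [RHS]mxE !tensmxE kdiffE [1%:M i j]mxE [1%:M a b]mxE.
  rewrite -[A i j * _](tr1 n) // mulr_sumr -big_split.
  apply: eq_bigr => k _; rewrite mulr_sumr -big_split; apply: eq_bigr => l _ /=.
  rewrite [X in _ = _ + X]mulrCA -mulrDr; congr (_ * _).
  have E c (t : 'I_p) (u : 'I_n) : cast_ord (esym (mulnA m p n))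
      (mxtens_index (mxtens_index (c, t), u))
      = mxtens_index (c, mxtens_index (t, u)).
    by apply: val_inj; rewrite /= mulnDl -mulnA addnA.
  have D1 q r (c c' : 'I_q) (t t' : 'I_r) :
      (1%:M : 'M[F]_(q * r)) (mxtens_index (c, t)) (mxtens_index (c', t'))
      = (c == c')%:R * (t == t')%:R.
    by rewrite mxE (can_eq (@mxtens_indexK _ _)) xpair_eqE -natrM mulnb.
  have AE q r (M N : 'M[F]_(q, r)) c d : (M + N) c d = M c d + N c d.
    by rewrite mxE.
  have NE q r (M : 'M[F]_(q, r)) c d : (- M) c d = - M c d by rewrite mxE.
  rewrite AE NE castmxE !E AE !tensmxE !D1 AE NE tensmxE [1%:M i j]mxE.
  by rewrite [1%:M a b]mxE mulrBr !mulrA addrA.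
- move=> m n _ _ A B C D; apply/matrixP=> i j; rewrite [RHS]mxE !kdiffE -big_split.
  apply: eq_bigr => k _; rewrite -big_split; apply: eq_bigr => l _ /=.
  by rewrite -mulrDr; congr (_ * _); rewrite !mxE mulrDr opprD addrACA.
move=> m n _ _ c A C; apply/matrixP=> i j; rewrite [RHS]mxE !kdiffE mulr_sumr.
apply: eq_bigr => k _; rewrite mulr_sumr; apply: eq_bigr => l _ /=.
rewrite [RHS]mulrCA; congr (_ * _).
by rewrite !mxE mulrBr; congr (_ - _); rewrite mulrCA.
Qed.

End Facts.

(* Main.v *)
(* In coordinates, A (-) B contracts A - I (x) B against v_n in its second
   tensor factor. Contracting twice amounts to contracting against v_p (x) v_q,
   and tr(v_n) = 1 makes the terms in Y and Z agree, so (a) says precisely that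
   v_(pq) = v_p (x) v_q for all positive p and q. Such a family is determined by
   its members at the primes. Conversely, if v_n is the product of the pi_q
   along one factorization of n into primes, then clause (b), together with
   unique factorization in N, makes it the product along every factorization;
   concatenating factorizations of p and q gives multiplicativity. *)
Require Import Defs.
From mathcomp Require Import all_boot all_order all_algebra.

Set Implicit Arguments.
Unset Strict Implicit.
Unset Printing Implicit Defensive.

Import GRing.Theory.
Local Open Scope ring_scope.

(** * Unique factorization of integers, for lists of primes *)

Lemma count_mem_primes (p : nat) (q : seq nat) :
  prime p -> all prime q -> count_mem p q = logn p (\prod_(i <- q) i).
Proof.
move=> pp; elim: q => [|i q IH] /=; first by rewrite big_nil logn1.
case/andP=> pi pq; rewrite big_cons lognM.
- by rewrite logn_prime // IH // eq_sym.
- exact: prime_gt0.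
by rewrite big_seq prodn_cond_gt0 // => j /(allP pq)/prime_gt0.
Qed.

(** The multiplicity of a prime in either list is its valuation in the common product. *)
Lemma perm_primes (q r : seq nat) :
  all prime q -> all prime r -> (\prod_(i <- q) i = \prod_(i <- r) i)%N ->
  perm_eq q r.
Proof.
move=> pq pr e; apply/allP=> p; rewrite mem_cat /= => qr.
have pp : prime p by case/orP: qr; [move/(allP pq) | move/(allP pr)].
by rewrite !count_mem_primes // e.
Qed.

(** Makes clause (b) applicable to an arbitrary nonempty list of primes. The list [r] repeats each
    prime of [s] according to its exponent; by unique factorization it is a permutation of [q],
    which gives the length. *)
Lemma prime_decomposition_of_primes (q : seq nat) :
  all prime q -> (0 < size q)%N ->
  exists s, prime_decomposition (\prod_(i <- q) i) s /\
            size q = (\sum_(f <- s) f.2)%N.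
Proof.
move=> pq q0; set n := (\prod_(i <- q) i)%N.
have n0 : (0 < n)%N.
  by rewrite /n big_seq prodn_cond_gt0 // => i /(allP pq)/prime_gt0.
set s := prime_decomp n.
have Es : (\prod_(f <- s) f.1 ^ f.2)%N = n by rewrite -prod_prime_decomp.
have ps f : f \in s -> prime f.1 && (0 < f.2)%N.
  by case: f => p e /mem_prime_decomp[-> ->].
pose r := flatten [seq nseq f.2 f.1 | f <- s].
have pr : all prime r.
  apply/allP=> p /flattenP[_ /mapP[f fs ->]] /nseqP[-> _].
  by case/andP: (ps f fs).
have rn : (\prod_(i <- r) i)%N = n.
  rewrite /r big_flatten big_map -Es; apply: eq_bigr => f _.
  by rewrite big_nseq iter_muln_1.
have sz : size q = (\sum_(f <- s) f.2)%N.
  rewrite (perm_size (perm_primes pq pr _)) ?rn // size_flatten sumnE !big_map.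
  by apply: eq_bigr => f _; rewrite size_nseq.
exists s; split=> //; split=> //.
- by rewrite lt0n size_eq0; apply: contraTneq q0 => s0; rewrite sz s0 big_nil.
- exact: (primes_uniq n).
exact/allP.
Qed.

(** * Size casts, associativity, and trace-one Kronecker factors *)

Section Kronecker.
Variable F : fieldType.

Lemma castsq_id m (e : m = m) (A : 'M[F]_m) : castsq e A = A.
Proof. exact: castmx_id. Qed.

Lemma castsq_trans m n p (e : m = n) (e' : n = p) (e'' : m = p)
  (A : 'M[F]_m) : castsq e' (castsq e A) = castsq e'' A.
Proof. by case: p / e' e'' => e''; case: n / e e'' => e''; rewrite !castsq_id. Qed.

Lemma castsq_inj m n (e : m = n) : injective (@castsq F m n e).
Proof. by case: n / e => A B; rewrite !castsq_id. Qed.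

Lemma castsq_family (v : forall n : nat, 'M[F]_n) m n (e : m = n) :
  castsq e (v m) = v n.
Proof. by case: n / e; rewrite castsq_id. Qed.

Lemma mxtrace_castsq m n (e : m = n) (A : 'M[F]_m) :
  \tr (castsq e A) = \tr A.
Proof. by case: n / e; rewrite castsq_id. Qed.

Lemma castsq_tens m m' n n' (e : m = m') (e' : n = n')
  (e'' : (m * n = m' * n')%N) (A : 'M[F]_m) (B : 'M[F]_n) :
  castsq e A *t castsq e' B = castsq e'' (A *t B).
Proof. by case: m' / e e''; case: n' / e' => e''; rewrite !castsq_id. Qed.

(** In row-major order both sides have the value i * (n * p) + j * p + k. *)
Lemma mxtens_indexA m n p (e : (m * n * p = m * (n * p))%N) (i : 'I_m)
  (j : 'I_n) (k : 'I_p) :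
  cast_ord e (mxtens_index (mxtens_index (i, j), k))
  = mxtens_index (i, mxtens_index (j, k)).
Proof. by apply: val_inj; rewrite /= mulnDl -mulnA addnA. Qed.

Lemma castsqAE m n p (e : (m * n * p = m * (n * p))%N) (X : 'M[F]_(m * n * p))
  i j k i' j' k' :
  castsq e X (mxtens_index (i, mxtens_index (j, k)))
             (mxtens_index (i', mxtens_index (j', k')))
  = X (mxtens_index (mxtens_index (i, j), k))
      (mxtens_index (mxtens_index (i', j'), k')).
Proof. by rewrite castmxE -!(mxtens_indexA e) !cast_ordK. Qed.

Lemma tensmxA m n p (e : (m * n * p = m * (n * p))%N) (A : 'M[F]_m)
  (B : 'M[F]_n) (C : 'M[F]_p) :
  castsq e (A *t B *t C) = A *t (B *t C).
Proof.
apply/matrixP=> x y; case: (mxtens_indexP x) => i x'.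
case: (mxtens_indexP x') => j k; case: (mxtens_indexP y) => i' y'.
by case: (mxtens_indexP y') => j' k'; rewrite castsqAE !tensmxE mulrA.
Qed.

Lemma tens_delta_mx m n (i i' : 'I_m) (j j' : 'I_n) :
  delta_mx i i' *t delta_mx j j'
  = delta_mx (mxtens_index (i, j)) (mxtens_index (i', j')) :> 'M[F]_(m * n).
Proof.
apply/matrixP=> x y; case: (mxtens_indexP x) => a b.
case: (mxtens_indexP y) => a' b'; rewrite tensmxE !mxE.
by rewrite !(can_eq (@mxtens_indexK _ _)) !xpair_eqE -natrM mulnb andbACA.
Qed.

(* The trace condition on both factors removes the freedom of rescaling them
   against each other: each factor is a partial trace of the product. *)
Lemma tensmx_inj_tr1 m n (A A' : 'M[F]_m) (B B' : 'M[F]_n) :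
  \tr A = 1 -> \tr A' = 1 -> \tr B = 1 -> \tr B' = 1 ->
  A *t B = A' *t B' -> A = A' /\ B = B'.
Proof.
move=> tA tA' tB tB' /matrixP e; split; apply/matrixP=> i j.
  rewrite -[LHS]mulr1 -[RHS]mulr1 -[in LHS]tB -tB' !mulr_sumr.
  by apply: eq_bigr => k _; rewrite -!tensmxE.
rewrite -[LHS]mul1r -[RHS]mul1r -[in LHS]tA -tA' !mulr_suml.
by apply: eq_bigr => k _; rewrite -!tensmxE.
Qed.

Lemma mxtrace_ntens m (A : 'M[F]_m) k : \tr A = 1 -> \tr (A ^t k) = 1.
Proof.
move=> tA; case: k => [|k]; first by rewrite ntensmx0 mxtrace1.
by elim: k => [|k IH] //; rewrite ntensmxSS mxtrace_tens IH tA mulr1.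
Qed.

Lemma ntensmx_inj_tr1 m (A B : 'M[F]_m) k : (0 < k)%N ->
  \tr A = 1 -> \tr B = 1 -> A ^t k = B ^t k -> A = B.
Proof.
case: k => [//|[//|k]] _ tA tB; rewrite !ntensmxSS => e.
by have [] := tensmx_inj_tr1 tA tB (mxtrace_ntens k.+1 tA)
  (mxtrace_ntens k.+1 tB) e.
Qed.

(** * Kronecker products along lists *)

Lemma mxtrace_kronprod (I : eqType) (d : I -> nat)
  (M : forall i, 'M[F]_(d i)) (s : seq I) :
  (forall i, i \in s -> \tr (M i) = 1) -> \tr (kronprod M s) = 1.
Proof.
elim: s => [|i s IH] tM; rewrite /= mxtrace_castsq; first by rewrite mxtrace1.
rewrite mxtrace_tens tM ?mem_head // IH ?mulr1 // => j js.
by rewrite tM // inE js orbT.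
Qed.

(** Head and tail of each product have trace one, so the factors can be split off one at a time. *)
Lemma kronprod_inj_tr1 (I : eqType) (d : I -> nat)
  (M N : forall i, 'M[F]_(d i)) (s : seq I) :
  (forall i, i \in s -> \tr (M i) = 1) ->
  (forall i, i \in s -> \tr (N i) = 1) ->
  kronprod M s = kronprod N s -> forall i, i \in s -> M i = N i.
Proof.
elim: s => [//|i s IH] tM tN /= /castsq_inj e.
have sub j : j \in s -> j \in i :: s by rewrite inE orbC => ->.
have tM' j (js : j \in s) := tM j (sub j js).
have tN' j (js : j \in s) := tN j (sub j js).
have [eM es] := tensmx_inj_tr1 (tM _ (mem_head _ _)) (tN _ (mem_head _ _))
  (mxtrace_kronprod tM') (mxtrace_kronprod tN') e.
by move=> j; rewrite inE => /predU1P[-> //|]; exact: IH.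
Qed.

(** Induction by associativity of the Kronecker product; the auxiliary equalities only carry sizes,
    and the chains of casts collapse to one. *)
Lemma kronprod_cat (I : Type) (d : I -> nat) (M : forall i, 'M[F]_(d i))
  (s t : seq I)
  (e : (\prod_(i <- s) d i * \prod_(i <- t) d i = \prod_(i <- s ++ t) d i)%N) :
  kronprod M (s ++ t) = castsq e (kronprod M s *t kronprod M t).
Proof.
elim: s e => [|i s IH] e /=.
  have e1 : (1 * \prod_(j <- t) d j = \prod_(j <- [::]) d j * \prod_(j <- t) d j)%N.
    by rewrite big_nil.
  rewrite -[kronprod M t in RHS](castsq_id erefl).
  rewrite (castsq_tens _ _ e1) tens_scalar1mx -/(castsq _ _).
  rewrite (castsq_trans _ _ (etrans (esym (mul1n _)) e1)).
  by rewrite (castsq_trans _ _ erefl) castsq_id.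
have e1 := esym (big_cat _ s t xpredT d) : (_ * _ = _)%N.
have e2 : (d i * \prod_(j <- s) d j * \prod_(j <- t) d j
  = d i * (\prod_(j <- s) d j * \prod_(j <- t) d j))%N by rewrite mulnA.
have e3 : (d i * (\prod_(j <- s) d j * \prod_(j <- t) d j)
  = d i * \prod_(j <- s ++ t) d j)%N by rewrite e1.
have e4 : (d i * \prod_(j <- s) d j * \prod_(j <- t) d j
  = \prod_(j <- i :: s) d j * \prod_(j <- t) d j)%N by rewrite big_cons.
rewrite (IH e1) -[M i in LHS](castsq_id erefl) (castsq_tens _ _ e3).
rewrite -(tensmxA e2) -[kronprod M t in RHS](castsq_id erefl).
rewrite (castsq_tens _ _ e4) (castsq_trans _ _ (etrans e2 e3)).
rewrite (castsq_trans _ _ (etrans (etrans e2 e3) (prodn_cons d i (s ++ t)))).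
by rewrite (castsq_trans _ _ (etrans (etrans e2 e3) (prodn_cons d i (s ++ t)))).
Qed.

(** * Iterated differences and multiplicativity of the family *)

Variable v : forall n : nat, 'M[F]_n.

(** Subtracting zero isolates the contraction against [v n]; with a matrix unit for [B], it reads
    off an entry of [v n]. *)
Lemma kdiff_tens0 m n (A : 'M[F]_m) (B : 'M[F]_n) :
  kdiff v (A *t B) 0 = (\sum_k \sum_l v n k l * B k l) *: A.
Proof.
apply/matrixP=> i j; rewrite kdiffE mxE mulr_suml.
apply: eq_bigr => k _; rewrite mulr_suml; apply: eq_bigr => l _.
by rewrite tensmx0 subr0 tensmxE [A i j * _]mulrC mulrA.
Qed.

Lemma sum_delta_mx n (A : 'M[F]_n) i j :
  \sum_k \sum_l A k l * (delta_mx i j : 'M[F]_n) k l = A i j.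
Proof.
rewrite (bigD1 i) //= (bigD1 j) //= mxE !eqxx mulr1.
rewrite !big1 ?addr0 // => [k ne|l ne]; last by rewrite mxE (negPf ne) andbF mulr0.
by rewrite big1 // => l _; rewrite mxE (negPf ne) mulr0.
Qed.

Definition kron_multiplicative : Prop :=
  forall m n : nat, (0 < m)%N -> (0 < n)%N -> v (m * n) = v m *t v n.

Hypothesis v_tr1 : forall n : nat, (0 < n)%N -> \tr (v n) = 1.

(** Brings a term free of the contracted indices under the contraction, as a multiple of the
    identity. *)
Lemma sum_tr1 n (x : F) : (0 < n)%N ->
  \sum_(k < n) \sum_(l < n) v n k l * (x * (k == l)%:R) = x.
Proof.
move=> /v_tr1 tv; rewrite -[RHS]mul1r -[in RHS]tv mulr_suml.
apply: eq_bigr => k _; rewrite (bigD1 k) //= eqxx mulr1 big1 ?addr0 // => l ne.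
by rewrite eq_sym (negPf ne) !mulr0.
Qed.

Lemma kdiff_assocP :
  (forall m p q : nat, (0 < m)%N -> (0 < p)%N -> (0 < q)%N ->
     forall (X : 'M[F]_(m * p * q)) (Y : 'M[F]_q) (Z : 'M[F]_p),
     kdiff v (kdiff v X Y) Z
     = kdiff v (castsq (esym (mulnA m p q)) X) (kronsum Z Y))
  <-> kron_multiplicative.
Proof.
split=> [assoc p q p0 q0|mult m p q m0 p0 q0 X Y Z].
  apply/matrixP=> x y; case: (mxtens_indexP x) => i j.
  case: (mxtens_indexP y) => i' j'; rewrite tensmxE.
  (* With m = 1, zero subtrahends and matrix units as factors, both sides of (a) become single
     entries of [v p], [v q] and [v (p * q)]. *)
  have := assoc 1 p q isT p0 q0
    (1%:M *t delta_mx i i' *t delta_mx j j') 0 0.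
  rewrite /kronsum tens0mx tensmx0 addr0 tensmxA tens_delta_mx !kdiff_tens0.
  have -> (c : F) (M : 'M[F]_(1 * p)) : kdiff v (c *: M) 0 = c *: kdiff v M 0.
    have [_ _ _ lin] := kdiff_uniform v_tr1.
    by rewrite -[in LHS](scaler0 _ c) lin.
  rewrite kdiff_tens0 !sum_delta_mx => /matrixP/(_ ord0 ord0).
  by rewrite !mxE !mulr1 mulrC.
apply/matrixP=> i j; rewrite !kdiffE sum_mxtens.
(* Indices of size p * q are split into pairs and the sums reordered to match the nested contraction
   on the left. *)
apply: eq_bigr => k _; rewrite [RHS]exchange_big /= sum_mxtens.
apply: eq_bigr => l _; rewrite exchange_big /=.
have AE n (M N : 'M[F]_n) c d : (M + N) c d = M c d + N c d by rewrite mxE.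
have NE n (M : 'M[F]_n) c d : (- M) c d = - M c d by rewrite mxE.
(* The term in [Z] lies outside the inner contraction over size q; trace one moves it inside, where
   it becomes the Z part of the Kronecker sum. *)
rewrite AE NE kdiffE tensmxE -(sum_tr1 ((1%:M : 'M_m) i j * Z k l) q0).
rewrite -sumrB mulr_sumr; apply: eq_bigr => s _.
rewrite -sumrB mulr_sumr; apply: eq_bigr => t _.
rewrite mult // tensmxE -mulrBr mulrA; congr (_ * _).
rewrite !AE !NE castsqAE -addrA -opprD /kronsum !tensmxE AE !tensmxE.
rewrite [1%:M s t]mxE [1%:M k l]mxE.
rewrite [1%:M (mxtens_index _) _]mxE (can_eq (@mxtens_indexK _ _)) xpair_eqE.
rewrite [1%:M i j]mxE -mulnb natrM; congr (_ - _).
by rewrite mulrDr addrC !mulrA.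
Qed.

(** * Multiplicative families and prime factorizations *)

Lemma family1 : v 1 = 1%:M.
Proof.
have := v_tr1 (ltn0Sn 0); rewrite /mxtrace big_ord1 => v1.
by apply/matrixP=> i j; rewrite !ord1 v1 mxE.
Qed.

Lemma kronprod_family (I : eqType) (d : I -> nat) (M : forall i, 'M[F]_(d i))
  (s : seq I) : kron_multiplicative ->
  (forall i, i \in s -> (0 < d i)%N /\ M i = v (d i)) ->
  kronprod M s = v (\prod_(i <- s) d i).
Proof.
move=> mult; elim: s => [|i s IH] dM /=.
  by rewrite -family1 castsq_family.
have sub j : j \in s -> j \in i :: s by rewrite inE orbC => ->.
have [di ->] := dM i (mem_head _ _).
rewrite IH => [|j js]; last exact: dM (sub j js).
rewrite -mult ?castsq_family // big_seq prodn_cond_gt0 // => j js.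
by have [] := dM j (sub j js).
Qed.

Lemma ntensmx_family m k : kron_multiplicative -> (0 < m)%N ->
  v m ^t k = v (m ^ k).
Proof.
move=> mult m0; case: k => [|k]; first by rewrite ntensmx0 family1.
elim: k => [|k IH]; first by [].
by rewrite ntensmxSS IH -mult ?expn_gt0 ?m0.
Qed.

Lemma kron_multiplicative_factorization :
  kron_multiplicative -> prime_factorization_family v v.
Proof.
move=> mult; split=> [p /prime_gt0/v_tr1//|n s [_ _ /allP ps _] e].
have vp : castsq e (kronpowers v s) = v n.
  rewrite /kronpowers kronprod_family ?castsq_family // => f /ps /andP[pf _].
  by rewrite expn_gt0 prime_gt0 // ntensmx_family ?prime_gt0.
split=> [//|sigma ts es f fs|q pq _ e'].
- have [pf jf] := andP (ps f fs).
  (* Uniqueness in two stages: the product determines each Kronecker power, and a power with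
     positive exponent determines its trace-one base. *)
  apply: (ntensmx_inj_tr1 jf); first exact: ts.
    exact/v_tr1/prime_gt0.
  apply: (kronprod_inj_tr1 (M := fun f => sigma f.1 ^t f.2)
    (N := fun f => v f.1 ^t f.2) _ _ _ fs) => [g gs|g gs|].
  + exact/mxtrace_ntens/ts.
  + have [pg _] := andP (ps g gs); exact/mxtrace_ntens/v_tr1/prime_gt0.
  by apply: (@castsq_inj _ _ e); rewrite -/(kronpowers sigma s) -es -vp.
rewrite vp /kronprimes kronprod_family ?castsq_family // => p /(allP pq) pp.
by rewrite prime_gt0.
Qed.

Lemma factorization_kronprimes (pi : forall n : nat, 'M[F]_n) n (q : seq nat)
  (e : (\prod_(i <- q) i)%N = n) :
  prime_factorization_family v pi -> all prime q ->
  v n = castsq e (kronprimes pi q).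
Proof.
move=> [_ fact] pq; case: (posnP (size q)) => [/size0nil q0|q0].
  (* The empty list means n = 1, which no [prime_decomposition] covers; there trace one alone forces
     the identity. *)
  rewrite q0 /= in e *; rewrite (castsq_trans _ _ (etrans (prodn_nil id) e)).
  by rewrite -family1 castsq_family.
have [s [ds sz]] := prime_decomposition_of_primes pq q0.
rewrite e in ds; have [_ _ _ es] := ds.
by have [-> _ eq_q] := fact n s ds es; exact: eq_q.
Qed.

Lemma factorization_multiplicative (pi : forall n : nat, 'M[F]_n) :
  prime_factorization_family v pi -> kron_multiplicative.
Proof.
move=> fact m n m0 n0.
(* Strong induction, splitting off the least prime divisor; 1 gets the empty list. *)
have primesP k : (0 < k)%N -> exists2 q, all prime q & (\prod_(i <- q) i)%N = k.
  elim/ltn_ind: k => k IH k0; case: (leqP k 1) => [k1|k1].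
    by exists [::] => //; rewrite big_nil; apply/eqP; rewrite eqn_leq k0.
  have pp := pdiv_prime k1; have dk := pdiv_dvd k.
  have [||q pq qk] := IH (k %/ pdiv k)%N.
  - by rewrite ltn_Pdiv // prime_gt1.
  - by rewrite divn_gt0 ?prime_gt0 // dvdn_leq.
  by exists (pdiv k :: q); rewrite /= ?pp // big_cons qk mulnC divnK.
have [q pq qm] := primesP m m0; have [r pr rn] := primesP n n0.
have e : (\prod_(i <- q ++ r) i = m * n)%N by rewrite big_cat qm rn.
have e1 := esym (big_cat _ q r xpredT id) : (_ * _ = _)%N.
rewrite (factorization_kronprimes e fact) ?all_cat ?pq //.
rewrite (factorization_kronprimes qm fact) //.
rewrite (factorization_kronprimes rn fact) //.
by rewrite (castsq_tens _ _ (etrans e1 e)) /kronprimes (kronprod_cat _ e1)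
  (castsq_trans _ _ (etrans e1 e)).
Qed.

End Kronecker.

Theorem corollary3 (F : fieldType) (v : forall n : nat, 'M[F]_n)
  (v_tr1 : forall n : nat, (0 < n)%N -> \tr (v n) = 1) :
  (forall m p q : nat, (0 < m)%N -> (0 < p)%N -> (0 < q)%N ->
     forall (X : 'M[F]_(m * p * q)) (Y : 'M[F]_q) (Z : 'M[F]_p),
     kdiff v (kdiff v X Y) Z
     = kdiff v (castsq (esym (mulnA m p q)) X) (kronsum Z Y))
  <->
  (exists pi : forall p : nat, 'M[F]_p,
     prime_factorization_family v pi /\
     forall pi' : forall p : nat, 'M[F]_p,
       prime_factorization_family v pi' ->
       forall p : nat, prime p -> pi' p = pi p).
Proof.
split=> [/(kdiff_assocP v_tr1) mult|[pi [fact _]]]; last first.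
  exact/(kdiff_assocP v_tr1)/(factorization_multiplicative v_tr1 fact).
have fact := kron_multiplicative_factorization v_tr1 mult.
exists v; split=> // pi' [tr' fact'] p pp.
(* The single factor p^1 expresses [v p] through [pi' p] alone, so the uniqueness clause for [v]
   identifies the two. *)
have dp : prime_decomposition p [:: (p, 1)].
  by split; rewrite //= ?pp // big_seq1 expn1.
have e : (\prod_(f <- [:: (p, 1)]) f.1 ^ f.2)%N = p by case: dp.
have [_ uniq_v _] := fact.2 p _ dp e; have [e' _ _] := fact' p _ dp e.
apply: (uniq_v pi' _ e' (p, 1)); last by rewrite mem_head.
by move=> f; rewrite inE => /eqP->; exact: tr'.
Qed.
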